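(* The continuous embedding $L\log_2L\log_4L(\mathbb{T})\hookrightarrow\mathfrak{W}$ holds; that is, there is an absolute constant $C>0$ such that $\|f\|_{\mathfrak{W}}\le C\|f\|_{L\log_2L\log_4L(\mathbb{T})}$ for all $f\in L\log_2L\log_4L(\mathbb{T})$.
   Context: $\mathbb{T}=\mathbb{R}/\mathbb{Z}$ is identified with $[0,1)$ with Lebesgue measure; functions are complex valued and measurable. $\mathbb{N}=\{0,1,2,\dots\}$. Iterated logarithms: $e_0=1$, $e_k=e^{e_{k-1}}$, and $\log_k(t)=\log(\cdots\log(e_k+t)\cdots)$ ($k$ logarithms). In particular $\log_1(t)=\log(e+t)$ and $\log_2(t)=\log\log(e^e+t)$. $L\log_2L\log_4L(\mathbb{T})$ is the Orlicz (Banach) space defined by a fixed Young function $\varphi_4$ with $\varphi_4(t)=t\log_2(t)\log_4(t)$ for $t>e_4$, with norm $\|f\|=\inf\{\lambda>0:\int_{\mathbb{T}}\varphi_4(|f(x)|/\lambda)\,dx\le1\}$. $\mathfrak{W}$ is the quasi-Banach rearrangement invariant space of functions $f$ on $\mathbb{T}$ with finite quasinorm $$\|f\|_{\mathfrak{W}}:=\inf\Big\{\sum_{k\in\mathbb{N}}\log_1(k)\,\|f_k\|_1\,\log_2\Big(\frac{\|f_k\|_\infty}{\|f_k\|_1}\Big)\;:\; f=\sum_{k\in\mathbb{N}}f_k,\ \ \sum_{k\in\mathbb{N}}|f_k|<\infty\ \text{a.e.}\Big\},$$ where a term with $f_k=0$ is understood to be $0$. *)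

(* Defs.v *)
From HB Require Import structures.
From mathcomp Require Import all_boot all_order all_algebra.
From mathcomp Require Import all_classical all_reals all_analysis.
From mathcomp Require Export complex.

Set Implicit Arguments.
Unset Strict Implicit.
Unset Printing Implicit Defensive.

Import Order.TTheory GRing.Theory Num.Theory.
Import numFieldNormedType.Exports.

Local Open Scope classical_set_scope.
Local Open Scope ring_scope.

Section Definitions.
Variable R : realType.

Definition e_ (k : nat) : R := iter k (@expR R) 1.

Definition log_ (k : nat) (t : R) : R := iter k (@ln R) (e_ k + t).

(* Young functions are only constrained on [0, +oo[. *)
Definition young (phi : R -> R) : Prop :=
  [/\ phi 0 = 0,
      {in `[0, +oo[ &, {homo phi : s t / s <= t}},
      convex_function (E := R^o) [set t : R | 0 <= t] phi &
      phi t @[t --> +oo] --> +oo].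

(* The circle R/Z, identified with [0, 1[: a function on it is represented by
   a function on R, whose values outside of [0, 1[ are irrelevant. *)
Definition circle : set R := `[0, 1[.

Notation mu := (@lebesgue_measure R).

(* Borel measurability on [0, 1[; every Lebesgue measurable function agrees
   almost everywhere with such a function. *)
Definition cmeasurable (f : R -> R[i]) : Prop :=
  measurable_fun circle (fun x => complex.Re (f x)) /\
  measurable_fun circle (fun x => complex.Im (f x)).

Definition cLnorm (p : \bar R) (f : R -> R[i]) : \bar R :=
  Lnorm mu p ((fun x => (Normc.normc (f x))%:E) \_ circle).

(* The Luxemburg norm; it is +oo when no l is admissible. *)
Definition orlicz_norm (phi : R -> R) (f : R -> R[i]) : \bar R :=
  ereal_inf [set l%:E | l in [set l : R | 0 < l /\
    (\int[mu]_(x in circle) (phi (Normc.normc (f x) / l))%:E <= 1)%E]].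

Definition orlicz_space (phi : R -> R) : set (R -> R[i]) :=
  [set f | cmeasurable f /\ (orlicz_norm phi f < +oo)%E].

(* [R[i]^o] carries the topology of the complex modulus. *)
Definition decomposes (f : R -> R[i]) (g : nat -> R -> R[i]) : Prop :=
  (forall k, cmeasurable (g k)) /\
  {ae mu, forall x, circle x ->
    (\sum_(k <oo) (Normc.normc (g k x))%:E < +oo)%E /\
    series (fun k => g k x : R[i]^o) @ \oo --> (f x : R[i]^o)}.

(* The first branch is the case g = 0 almost everywhere. The term is +oo when g
   is not essentially bounded, since [er_map] sends +oo to +oo. *)
Definition W_term (k : nat) (g : R -> R[i]) : \bar R :=
  if cLnorm 1 g == 0%E then 0%E else
  ((log_ 1 k%:R)%:E * cLnorm 1 g *
    er_map (log_ 2) (cLnorm +oo g / cLnorm 1 g))%E.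

Definition W_norm (f : R -> R[i]) : \bar R :=
  ereal_inf [set (\sum_(k <oo) W_term k (g k))%E | g in decomposes f].

End Definitions.

(* Main.v *)
Require Import Defs.
From mathcomp Require Import all_boot all_order all_algebra.
From mathcomp Require Import all_classical all_reals all_analysis.
From mathcomp Require Import measurable_realfun ess_sup_inf ring lra.

(** It suffices to bound W_norm f by C * l for every l > 0 that is admissible
in the infimum defining the Orlicz norm of f, with C independent of f and
l; taking the infimum over l then covers functions of norm 0 as well.

Put u = |f| / l, so that the integral of phi (u) over the circle is at most 1,
and cut f along the level sets of u at the heights T_k = exp (exp (exp (e + k))).
These heights fit the two logarithms exactly: on the piece where
T_k < u <= T_{k+1}, the quantity log_2 u is at least exp (e + k), which is
comparable to log_2 T_{k+1}, while log_4 u is at least log (e + k) = log_1 k,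
which is at least half of the weight log_1 (k + 1) of that piece.  Hence
  log_1 k * log_2 T_k * u <= C' (phi (u) + B)
on the k-th piece, for every k ([level_weight]); the constant B pays for the lowest
piece, u <= T_0 = e_4, where phi is not given by its formula.

If n is the integral of u over the k-th piece, then the k-th term of the
quasinorm is at most l * log_1 k * n * log_2 (T_k / n), and the danger is a small
n.  Since log_2 is subadditive under products ([log2M]) and grows at most
linearly, inserting T_k / n = T_k * T_k * (1 / (n T_k)) gives
  n log_2 (T_k / n) <= (2 + e_2) n log_2 T_k + 1 / T_k
([mul_log2_div]) whatever the size of n.  The first part is controlled by the
integral of phi (u) + B over the k-th piece, and these integrals add up to at most
1 + B; the second part, weighted by log_1 k, is dominated by a geometric series
because T_k grows so fast ([log1_level]). *)

Set Implicit Arguments.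
Unset Strict Implicit.
Unset Printing Implicit Defensive.
Import Order.TTheory GRing.Theory Num.Theory.
Import numFieldNormedType.Exports.
Local Open Scope classical_set_scope.
Local Open Scope ring_scope.

(** * Growth of the iterated logarithms *)

Section IteratedLogarithms.
Variable R : realType.
Implicit Types (a b s t u x y : R) (j k : nat).

Lemma ln_le x y : 0 < y -> y <= expR x -> ln y <= x.
Proof. by move=> y0 yx; rewrite -[leRHS]expRK ler_ln ?posrE ?expR_gt0. Qed.

Lemma le_ln x y : expR x <= y -> x <= ln y.
Proof.
move=> xy; rewrite -[leLHS]expRK ler_ln ?posrE ?expR_gt0//.
exact: lt_le_trans (expR_gt0 _) xy.
Qed.

Lemma expR1_ge2 : 2 <= expR 1 :> R.
Proof. by rewrite (_ : 2 = 1 + 1)//; exact: expR_ge1Dx. Qed.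

Lemma expR_ge_double x : 0 <= x -> 2 * x <= expR x.
Proof.
move=> x0; have := expR_ge1Dx (x / 2).
have -> : expR x = expR (x / 2) * expR (x / 2) by rewrite -expRD; congr expR; lra.
move=> h; apply: (@le_trans _ _ ((1 + x / 2) * (1 + x / 2))).
  by have := sqr_ge0 (1 - x / 2); rewrite expr2; lra.
by apply: ler_pM; lra.
Qed.

Lemma log1E t : log_ 1 t = ln (e_ R 1 + t). Proof. by []. Qed.

Lemma log2E t : log_ 2 t = ln (ln (e_ R 2 + t)). Proof. by []. Qed.

Lemma log4E t : log_ 4 t = ln (ln (ln (ln (e_ R 4 + t)))). Proof. by []. Qed.

Lemma ln_e2D_ge2 t : 0 <= t -> 2 <= ln (e_ R 2 + t).
Proof.
move=> t0; apply: (le_trans expR1_ge2); apply: le_ln.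
by rewrite /e_/= lerDl.
Qed.

Lemma e2_ge1 : 1 <= e_ R 2.
Proof. by rewrite /e_/= -expR0 ler_expR expR_ge0. Qed.

Lemma log2_ge1 t : 0 <= t -> 1 <= log_ 2 t.
Proof.
by move=> t0; apply/le_ln/le_ln; rewrite /e_/= lerDl.
Qed.

Lemma ler_log2 s t : 0 <= s -> s <= t -> log_ 2 s <= log_ 2 t.
Proof.
move=> s0 st; have := e2_ge1 => K1.
have := ln_e2D_ge2 s0; have := ln_e2D_ge2 (le_trans s0 st) => ? ?.
have h : ln (e_ R 2 + s) <= ln (e_ R 2 + t) by rewrite ler_ln ?posrE; lra.
by rewrite !log2E ler_ln ?posrE//; lra.
Qed.

Lemma log2_le t : 0 <= t -> log_ 2 t <= e_ R 2 + t.
Proof.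
move=> t0; have K1 := e2_ge1; have L2 := ln_e2D_ge2 t0.
apply: (@le_trans _ _ (ln (e_ R 2 + t))); apply/ltW/ln_sublinear; lra.
Qed.

(** With K = e_2 one has K + a b <= (K + a) (K + b), so the inner logarithm is at
most the sum of ln (K + a) and ln (K + b).  Both are at least 2, hence their sum
is at most their product, and the outer logarithm splits. *)
Lemma log2M a b : 0 <= a -> 0 <= b -> log_ 2 (a * b) <= log_ 2 a + log_ 2 b.
Proof.
move=> a0 b0; have K1 := e2_ge1.
have A2 := ln_e2D_ge2 a0; have B2 := ln_e2D_ge2 b0.
have AB2 := ln_e2D_ge2 (mulr_ge0 a0 b0).
rewrite !log2E -lnM ?posrE; [|lra|lra].
rewrite ler_ln ?posrE; [|lra|nra].
apply: (@le_trans _ _ (ln (e_ R 2 + a) + ln (e_ R 2 + b))); last by nra.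
have ab0 := mulr_ge0 a0 b0; set K := e_ R 2 in K1 *.
have Ka : 0 <= K * a by rewrite mulr_ge0//; lra.
have Kb : 0 <= K * b by rewrite mulr_ge0//; lra.
have KK : K <= K * K by rewrite ler_peMl//; lra.
rewrite -lnM ?posrE; [|lra|lra].
rewrite (_ : (K + a) * (K + b) = K * K + K * a + K * b + a * b); last by ring.
by rewrite ler_ln ?posrE; lra.
Qed.

(** Trading an additive error [t^-1] for uniformity in [n]: the factor [1 / n] of
the argument is written as [t * (n * t)^-1], so that the linear bound on [log_ 2],
used only at [(n * t)^-1], costs [n * (n * t)^-1 = t^-1] and [n * e_ R 2], which is
absorbed because [log_ 2 t >= 1]. *)
Lemma mul_log2_div n t : 0 < n -> 1 <= t ->
  n * log_ 2 (t / n) <= (2 + e_ R 2) * (n * log_ 2 t) + t^-1.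
Proof.
move=> n0 t1; have K1 := e2_ge1.
have t0 : 0 < t by lra.
have nt0 : 0 < (n * t)^-1 by rewrite invr_gt0 mulr_gt0.
have L1 : 1 <= log_ 2 t by apply: log2_ge1; lra.
have -> : t / n = t * (t * (n * t)^-1).
  by field; rewrite !gt_eqF.
have h1 : log_ 2 (t * (t * (n * t)^-1)) <=
    log_ 2 t + (log_ 2 t + (e_ R 2 + (n * t)^-1)).
  apply: (le_trans (log2M _ _)); [lra|nra|rewrite lerD2l].
  by apply: (le_trans (log2M _ _)); [lra|lra|rewrite lerD2l log2_le//; lra].
apply: (le_trans (ler_wpM2l (ltW n0) h1)).
have -> : t^-1 = n * (n * t)^-1 by field; rewrite !gt_eqF.
have h2 : 0 <= n * e_ R 2 * (log_ 2 t - 1) by rewrite !mulr_ge0; lra.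
set m := (n * t)^-1; lra.
Qed.

(** * The cutting heights *)

(** The heights at which a function is cut.  Here [e_ R 1 + k] is the argument of
the logarithm in the weight [log_ 1 k], and the three exponentials make
[log_ 4] of the [k]-th height comparable to that weight. *)
Definition level k : R := expR (expR (expR (e_ R 1 + k%:R))).

(** The cut starts where the formula for the Young function becomes valid. *)
Lemma level0 : level 0 = e_ R 4.
Proof. by rewrite /level addr0. Qed.

Lemma e1D_ge2 k : 2 <= e_ R 1 + k%:R.
Proof. by have := expR1_ge2; have := ler0n R k; rewrite /e_/=; lra. Qed.

Lemma level_ge1 k : 1 <= level k.
Proof. by rewrite /level -expR0 ler_expR expR_ge0. Qed.

Lemma ler_level j k : (j <= k)%N -> level j <= level k.
Proof. by move=> jk; rewrite !ler_expR lerD2l ler_nat. Qed.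

Lemma log1_ge1 k : 1 <= log_ 1 k%:R :> R.
Proof. by apply: le_ln; rewrite /e_/= lerDl. Qed.

(** As [e_ R 1 + k >= 2], its square dominates [e_ R 1 + k + 1]. *)
Lemma log1S k : log_ 1 k.+1%:R <= 2 * log_ 1 k%:R :> R.
Proof.
have := e1D_ge2 k => h; rewrite !log1E mulr_natl -lnXn; last by lra.
rewrite ler_ln ?posrE -?natr1; nra.
Qed.

Lemma level_gt_nat k : k%:R < level k.
Proof.
have h x : x < expR x by have := expR_ge1Dx x; lra.
have e0 : 0 <= e_ R 1 by exact: expR_ge0.
apply: (@le_lt_trans _ _ (e_ R 1 + k%:R)); first by rewrite lerDr.
exact: lt_trans (h _) (lt_trans (h _) (h _)).
Qed.

(** The summand [e_ R 2] and the factor 2 cost at most a square, once inside each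
exponential. *)
Lemma log2_level k : log_ 2 (level k) <= 2 * expR (e_ R 1 + k%:R).
Proof.
set x := e_ R 1 + k%:R; have x2 : 2 <= x := e1D_ge2 k.
have y2 : 2 * x <= expR x by apply: expR_ge_double; lra.
have L2 := ln_e2D_ge2 (le_trans ler01 (level_ge1 k)).
rewrite log2E mulr_natl mulr2n; apply: ln_le; first by lra.
apply: (@le_trans _ _ (2 * expR (expR x))); last first.
  rewrite (expRD (expR x)) ler_pM2r ?expR_gt0//.
  by apply: (le_trans _ (expR_ge1Dx _)); lra.
apply: ln_le; first by have := e2_ge1; have := level_ge1 k; lra.
rewrite mulr_natl mulr2n (expRD (expR (expR x))).
have hK : e_ R 2 <= expR (expR x).
  by rewrite /e_/= !ler_expR; apply: (@le_trans _ _ 2); lra.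
have h2 : 2 <= expR (expR x) by apply: (le_trans _ (expR_ge1Dx _)); lra.
have hT : expR (expR x) <= level k.
  by rewrite /level -/x !ler_expR; have := expR_ge1Dx x; lra.
rewrite -/(level k) in hT *; nra.
Qed.

(** With x = e + k, the weight is at most [expR x] and the height at least
[expR (2 * x)], so the quotient is at most [expR (- k)]; the form of the right-hand
side is the summand of the geometric series of sum 2. *)
Lemma log1_level k : log_ 1 k%:R / level k <= 2 / (2 ^ k.+1)%:R.
Proof.
set x := e_ R 1 + k%:R; have x2 : 2 <= x := e1D_ge2 k.
have y2 : 2 * x <= expR x by apply: expR_ge_double; lra.
rewrite ler_pdivrMr; last by have := level_ge1 k; lra.
have -> : 2 / (2 ^ k.+1)%:R = ((2 : R) ^+ k)^-1.
  by rewrite natrX exprS invfM mulrA divff ?mul1r// pnatr_eq0.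
rewrite mulrC ler_pdivlMr ?exprn_gt0//.
apply: (@le_trans _ _ (expR x * expR x)).
  apply: ler_pM; [have := log1_ge1 k; lra|exact: exprn_ge0| |].
    rewrite log1E -/x; apply: ln_le; first by lra.
    by have := expR_ge1Dx x; have := expR_ge1Dx (expR x); lra.
  apply: (@le_trans _ _ (expR 1 ^+ k)).
    by apply: lerXn2r; rewrite ?nnegrE ?expR_ge0// expR1_ge2.
  by rewrite -expRM_natl mulr1 ler_expR /x lerDr expR_ge0.
rewrite -expRD /level -/x ler_expR.
have := expR_ge1Dx (expR x); lra.
Qed.

Lemma log2_log4_level k u : level k < u ->
  log_ 1 k%:R * expR (e_ R 1 + k%:R) <= log_ 2 u * log_ 4 u.
Proof.
move=> ku; rewrite mulrC; apply: ler_pM.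
- exact: expR_ge0.
- by have := log1_ge1 k; lra.
- apply/le_ln/le_ln; have := e2_ge1; rewrite /level in ku; lra.
- rewrite log1E log4E ler_ln ?posrE.
  + apply/le_ln/le_ln/le_ln.
    by apply: (le_trans (ltW ku)); rewrite lerDr expR_ge0.
  + by have := e1D_ge2 k; rewrite /e_/=; lra.
  + apply: (@lt_le_trans _ _ 1) => //; apply/le_ln/le_ln/le_ln.
    have : level 0 < e_ R 4 + u.
      by rewrite level0 ltrDl; have := level_ge1 k; lra.
    rewrite /level addr0 => /ltW; apply: le_trans.
    by rewrite !ler_expR; have := expR1_ge2; rewrite /e_/=; lra.
Qed.

(** The lower bound -1 lets the lowest piece contain the zeros of the modulus. *)
Definition level_lo k : R := if k is j.+1 then level j else - 1.

(** The arithmetic of [level_weight] on the pieces above the lowest one. Here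
[a] and [l] stand for two consecutive weights, [b] for [log_ 2] of the upper
height, [X] for the exponential bounding it, and [L], [L'] for [log_ 2] and
[log_ 4] of [u]. *)
Lemma level_weight_arith e u X a l b L L' B : 2 <= e -> 0 <= u ->
  1 <= a -> 1 <= b -> a <= 2 * l -> b <= 2 * (e * X) -> l * X <= L * L' ->
  0 <= B -> a * b * u <= 4 * e * (u * L * L' + B).
Proof.
move=> e2 u0 a1 b1 al bX lX B_ge0.
have h4 : a * b <= (2 * l) * (2 * (e * X)) by apply: ler_pM => //; lra.
have h5 : (a * b) * u <= (4 * e * (l * X)) * u by apply: ler_wpM2r => //; lra.
have h6 : 4 * e * u * (l * X) <= 4 * e * u * (L * L').
  by apply: ler_wpM2l => //; rewrite mulr_ge0//; lra.
have h7 : 0 <= e * B by rewrite mulr_ge0//; lra.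
lra.
Qed.

Definition base_weight : R := log_ 2 (level 0) * level 0.

Lemma base_weight_ge0 : 0 <= base_weight.
Proof.
have T0 := le_trans ler01 (level_ge1 0).
exact: mulr_ge0 (le_trans ler01 (log2_ge1 T0)) T0.
Qed.

(** On each piece the Young function dominates [u] times the two logarithmic
factors of the quasinorm.  On the lowest piece, where [phi] is not given by its
formula, the constant [base_weight] replaces it. *)
Lemma level_weight phi k u :
  (forall t, 0 <= t -> 0 <= phi t) ->
  (forall t, e_ R 4 < t -> phi t = t * log_ 2 t * log_ 4 t) ->
  0 <= u -> level_lo k < u -> u <= level k ->
  log_ 1 k%:R * log_ 2 (level k) * u <=
    4 * expR 1 * (phi u + base_weight).
Proof.
move=> phi0 phiE u0; have := phi0 _ u0; have := expR1_ge2.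
have T0 := level_ge1 0; have L0 := log2_ge1 (le_trans ler01 T0).
set e := expR 1 => e2 pu.
case: k => [_ uT|k /= ku _].
  rewrite /base_weight.
  have -> : log_ 1 0%:R = 1 :> R by rewrite /log_/= addr0 expRK.
  have h : log_ 2 (level 0) * u <= log_ 2 (level 0) * level 0 by nra.
  have h0 : 0 <= log_ 2 (level 0) * level 0 by nra.
  rewrite mul1r; apply: (le_trans h); nra.
rewrite [in leRHS]phiE; last first.
  by rewrite -level0; apply: le_lt_trans ku; exact: ler_level.
have h1 := log1S k; have h2 := log2_level k.+1; have h3 := log2_log4_level ku.
have g1 := log1_ge1 k.+1; have g2 := log2_ge1 (le_trans ler01 (level_ge1 k.+1)).
have E1 : expR (e_ R 1 + k.+1%:R) = e * expR (e_ R 1 + k%:R).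
  by rewrite -natr1 addrA [LHS]expRD mulrC.
rewrite {}E1 in h2.
exact: (level_weight_arith e2 u0 g1 g2 h1 h2 h3 base_weight_ge0).
Qed.

Definition piece_const : R := (2 + e_ R 2) * (4 * expR 1).

Lemma piece_const_ge0 : 0 <= piece_const.
Proof.
have := e2_ge1; have := expR1_ge2 => ? ?; rewrite /piece_const !mulr_ge0//; lra.
Qed.

End IteratedLogarithms.

(** * The level-set decomposition *)

Section LevelSets.
Variable R : realType.
Implicit Types (r : R) (j k : nat).

Definition in_level k r := (level_lo R k < r) && (r <= level R k).

(** The heights are unbounded, and the least one that is not exceeded decides. *)
Lemma in_level_ex r : 0 <= r -> exists k, in_level k r.
Proof.
move=> r0; have ex : exists k, r <= level R k.
  exists (Num.bound r); apply/ltW/(lt_trans (archi_boundP r0)).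
  exact: level_gt_nat.
have [[|k] rk min_k] := ex_minnP ex.
  by exists 0%N; rewrite /in_level rk andbT; apply: lt_le_trans r0; rewrite ltrN10.
exists k.+1; rewrite /in_level rk andbT /= ltNge; apply/negP => /min_k.
by rewrite ltnn.
Qed.

Lemma in_level_inj j k r : in_level j r -> in_level k r -> j = k.
Proof.
wlog jk : j k / (j <= k)%N.
  move=> wl; have /orP[jk|kj] := leq_total j k; first exact: wl.
  by move=> rj rk; apply/esym/wl.
move: jk; rewrite leq_eqVlt => /orP[/eqP//|]; case: k => // k jk.
move=> /andP[_ rj] /andP[/= kr _].
suff : level R j <= level R k.
  by move=> /(le_trans rj)/(lt_le_trans kr); rewrite ltxx.
exact: ler_level.
Qed.

End LevelSets.

Section Modulus.
Variable R : realType.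

Lemma normc_ge0 (z : R[i]) : 0 <= Normc.normc z.
Proof. by case: z => a b; exact: sqrtr_ge0. Qed.

Lemma measurable_normc (f : R -> R[i]) : cmeasurable f ->
  measurable_fun (@circle R) (fun x => Normc.normc (f x)).
Proof.
move=> [mre mim].
have -> : (fun x => Normc.normc (f x)) =
    (@Num.sqrt R \o (fun x => complex.Re (f x) ^+ 2 + complex.Im (f x) ^+ 2)).
  by apply/funext => x /=; case: (f x).
apply: measurableT_comp.
  by apply: continuous_measurable_fun; exact: sqrt_continuous.
by apply: measurable_funD; exact: measurable_funX.
Qed.

End Modulus.

Section Decomposition.
Variables (R : realType) (phi : R -> R) (f : R -> R[i]) (l : R).
Hypothesis phi_ge0 : forall t, 0 <= t -> 0 <= phi t.
Hypothesis phi_homo : {in `[0, +oo[ &, {homo phi : s t / s <= t}}.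
Hypothesis phiE : forall t : R, e_ R 4 < t -> phi t = t * log_ 2 t * log_ 4 t.
Hypothesis f_meas : cmeasurable f.
Hypothesis l_gt0 : 0 < l.

Notation mu := (@lebesgue_measure R).
Let u x := Normc.normc (f x) / l.
Let E k := @circle R `&` [set x | in_level k (u x)].
Let g k x := if in_level k (u x) then f x else 0.

Let u_ge0 x : 0 <= u x.
Proof. by rewrite divr_ge0 ?normc_ge0 ?ltW. Qed.

Let mcircle : measurable (@circle R).
Proof. exact: measurable_itv. Qed.

Let mu_circle : mu (@circle R) = 1%E.
Proof. by rewrite lebesgue_measure_itv/= lte_fin ltr01 -EFinD subr0. Qed.

Let mu_meas : measurable_fun (@circle R) u.
Proof. by apply: measurable_funM => //; exact: measurable_normc. Qed.

Let in_level_meas k : measurable_fun (@circle R) (fun x => in_level k (u x)).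
Proof.
apply: measurable_and; first exact: measurable_fun_ltr.
exact: measurable_fun_ler.
Qed.

Let mE k : measurable (E k).
Proof.
have := in_level_meas k mcircle (Y := [set true]) I.
by rewrite /E; congr measurable.
Qed.

(** A monotone function is measurable, but [phi] is monotone only on the
nonnegative half-line; it is therefore extended by its value at 0. *)
Let phi_u_meas : measurable_fun (@circle R) (phi \o u).
Proof.
apply: (eq_measurable_fun ((phi \o Num.max 0) \o u)).
  by move=> x _ /=; rewrite max_r.
apply: measurableT_comp => //; apply: nondecreasing_measurable => //.
have max0 (r : R) : Num.max 0 r \in `[0, +oo[ by rewrite in_itv/= andbT le_max lexx.
move=> s t st; apply: phi_homo => //.
by rewrite ge_max !le_max lexx st orbT.
Qed.

Let Eu_meas k : measurable_fun (E k) (EFin \o u).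
Proof.
by apply/measurable_EFinP; apply: measurable_funS mu_meas => //; exact: subIsetl.
Qed.

Let Eu_ge0 k x : E k x -> (0 <= (u x)%:E)%E.
Proof. by rewrite lee_fin. Qed.

(** At each point all pieces but one vanish, so both series reduce to a single
term. *)
Lemma level_pieces_decompose : decomposes f g.
Proof.
split=> [k|].
  have [mre mim] := f_meas.
  have gE (p : R[i] -> R) : p 0 = 0 -> (fun x => p (g k x)) =
      (fun x => if in_level k (u x) then p (f x) else 0).
    by move=> p0; apply/funext => x; rewrite /g; case: ifP.
  split; rewrite gE//; apply: measurable_fun_if => //.
    by apply: measurable_funS mre => // x [].
  by apply: measurable_funS mim => // x [].
apply: aeW => x _; have [k0 k0x] := in_level_ex (u_ge0 x).
have g0 k : k != k0 -> g k x = 0.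
  by rewrite /g; case: ifP => // kx /eqP; case; exact: in_level_inj kx k0x.
have gk0 : g k0 x = f x by rewrite /g k0x.
split.
  rewrite (nneseriesD1 (n := k0))//; last by move=> k _; rewrite lee_fin normc_ge0.
  rewrite eseries0 ?adde0 ?ltry// => k _ /andP[_ kk0].
  by rewrite g0// Normc.normc0.
apply: cvg_near_cst; near=> n.
rewrite /series/= (bigD1_seq k0)/= ?iota_uniq//; last first.
  by rewrite mem_index_iota/=; near: n; exact: nbhs_infty_gt.
by rewrite big1 ?addr0// => k; exact: g0.
Unshelve. all: by end_near. Qed.

(** * Estimate of the pieces *)

Lemma cLnorm1_piece k :
  cLnorm 1 (g k) = (l%:E * \int[mu]_(x in E k) (u x)%:E)%E.
Proof.
rewrite -(ge0_integralZl_EFin mu (@mE k) (@Eu_ge0 k) (@Eu_meas k) (ltW l_gt0)).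
rewrite [RHS]integral_mkcond; apply: (eq_trans (Lnorm1 _ _)).
apply: eq_integral => x _.
rewrite !patchE /E /g in_setI; case: ifPn => xc; last by rewrite abse0.
case: ifPn => kx; last first.
  rewrite [x \in [set _ | _]]memNset; last exact/negP.
  by rewrite andbF Normc.normc0 abse0.
by rewrite mem_set// -EFinM mulrC divfK ?gt_eqF// /= ger0_norm ?normc_ge0.
Qed.

Lemma cLnormy_piece k : (cLnorm +oo (g k) <= (l * level R k)%:E)%E.
Proof.
rewrite /cLnorm unlock /=; case: ifP => _; last first.
  by rewrite lee_fin mulr_ge0 ?ltW//; have := level_ge1 R k; lra.
apply/ess_supP/nearW => x /=; rewrite patchE.
have lT : 0 <= l * level R k.
  by rewrite mulr_ge0 ?ltW//; have := level_ge1 R k; lra.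
case: ifPn => _; last by rewrite /= normr0 lee_fin.
rewrite /= ger0_norm ?normc_ge0// lee_fin /g.
case: ifPn => [/andP[_]|_]; last by rewrite Normc.normc0.
by rewrite ler_pdivrMr// mulrC.
Qed.

Lemma integral_piece_le k : (\int[mu]_(x in E k) (u x)%:E <= (level R k)%:E)%E.
Proof.
have T0 : 0 <= level R k by have := level_ge1 R k; lra.
apply: (@le_trans _ _ (\int[mu]_(x in E k) (level R k)%:E)%E).
  apply: (ge0_le_integral mu (@mE k) (@Eu_ge0 k) (@Eu_meas k)).
    exact: measurable_cst.
  by move=> x [_ /andP[_]]; rewrite lee_fin.
rewrite (integral_cst mu (@mE k)) -[leRHS]mule1; apply: lee_wpmul2l => //.
rewrite -mu_circle; apply: le_measure; rewrite ?inE//; first exact: mE.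
exact: subIsetl.
Qed.

Let B := base_weight R.

Let B_ge0 : 0 <= B := base_weight_ge0 R.

Let D := piece_const R.

Let D_ge0 : 0 <= D := piece_const_ge0 R.

Lemma weighted_integral_piece_le k :
  ((log_ 1 k%:R * log_ 2 (level R k))%:E * \int[mu]_(x in E k) (u x)%:E <=
   (4 * expR 1)%:E * \int[mu]_(x in E k) (phi (u x) + B)%:E)%E.
Proof.
have T0 := le_trans ler01 (level_ge1 R k).
have w0 := mulr_ge0 (le_trans ler01 (log1_ge1 R k)) (le_trans ler01 (log2_ge1 T0)).
have e0 : 0 <= 4 * expR 1 :> R by rewrite mulr_ge0 ?expR_ge0.
have pB0 x : E k x -> (0 <= (phi (u x) + B)%:E)%E.
  by move=> _; rewrite lee_fin addr_ge0 ?phi_ge0.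
have pmE : measurable_fun (E k) (fun x => (phi (u x) + B)%:E).
  apply/measurable_EFinP; apply: measurable_funD => //.
  by apply: measurable_funS phi_u_meas => //; exact: subIsetl.
rewrite -(ge0_integralZl_EFin mu (@mE k) (@Eu_ge0 k) (@Eu_meas k) w0).
rewrite -(ge0_integralZl_EFin mu (@mE k) pB0 pmE e0).
apply: (ge0_le_integral mu (@mE k)).
- by move=> x Ex; apply: mule_ge0; [rewrite lee_fin|exact: Eu_ge0 Ex].
- by apply: measurable_funeM; exact: Eu_meas.
- exact: measurable_funeM.
move=> x [_ /andP[lo hi]]; rewrite -!EFinM lee_fin.
exact: level_weight.
Qed.

(** The term is estimated by [mul_log2_div] with [n] the integral of [u] over the
piece.  The nonnegativity is needed in order to compare the series termwise. *)
Lemma W_term_piece k : (0 <= W_term k (g k) /\ W_term k (g k) <=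
  (D * l)%:E * \int[mu]_(x in E k) (phi (u x) + B)%:E
    + (2 * l / (2 ^ k.+1)%:R)%:E)%E.
Proof.
set J := (\int[mu]_(x in E k) (phi (u x) + B)%:E)%E.
have J0 : (0 <= J)%E.
  by apply: integral_ge0 => x _; rewrite lee_fin addr_ge0 ?phi_ge0.
have rest0 : 0 <= 2 * l / (2 ^ k.+1)%:R by rewrite divr_ge0 ?mulr_ge0 ?ltW.
have DlJ0 : (0 <= (D * l)%:E * J)%E.
  by rewrite mule_ge0// lee_fin mulr_ge0 ?(ltW l_gt0).
rewrite /W_term; case: ifPn => [_|N1].
  by split=> //; rewrite adde_ge0.
have w := weighted_integral_piece_le k; rewrite -/J in w.
have := cLnormy_piece k.
have Noo0 : (0 <= cLnorm +oo (g k))%E by exact: Lnorm_ge0.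
rewrite cLnorm1_piece in N1 *.
have := integral_piece_le k.
have : (0 <= \int[mu]_(x in E k) (u x)%:E)%E.
  by apply: integral_ge0 => x _; rewrite lee_fin.
move: Noo0 N1 w.
case: (\int[mu]_(x in E k) (u x)%:E)%E => [n| |]//.
case: (cLnorm +oo (g k)) => [m| |]//.
rewrite -!EFinM !lee_fin eqe => m0 ln0 w n_ge0 nT mT.
have n0 : 0 < n.
  by rewrite lt0r n_ge0 andbT; apply: contra_neq ln0 => ->; rewrite mulr0.
rewrite inver (negbTE ln0) /= -?EFinM lee_fin.
have ml0 : 0 <= m / (l * n) by rewrite divr_ge0// mulr_ge0// ltW.
have T1 := level_ge1 R k.
have l1 := log1_ge1 R k; have l2 := log2_ge1 ml0.
split.
  apply: mulr_ge0; last exact: le_trans l2.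
  by apply: mulr_ge0; [exact: le_trans l1|exact: mulr_ge0 (ltW l_gt0) n_ge0].
have h1 : log_ 2 (m / (l * n)) <= log_ 2 (level R k / n).
  apply: ler_log2 => //.
  by rewrite ler_pdivrMr ?mulr_gt0// mulrCA divfK ?gt_eqF.
have h2 := mul_log2_div n0 T1.
have h3 := log1_level R k.
(* The bound of [mul_log2_div], multiplied by the weight and by [l], and with its
   error term replaced by the geometric one. *)
apply: (@le_trans _ _ ((2 + e_ R 2) * l * (log_ 1 k%:R * log_ 2 (level R k) * n)
   + 2 * l / (2 ^ k.+1)%:R)%:E).
  rewrite lee_fin.
  have h4 := ler_wpM2l n_ge0 h1.
  have h5 := ler_wpM2l (le_trans ler01 l1) (le_trans h4 h2).
  have h6 := ler_wpM2l (ltW l_gt0) h5.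
  have h7 := ler_wpM2l (ltW l_gt0) h3.
  move: h6 h7.
  move: (log_ 1 _) (log_ 2 (m / _)) (log_ 2 (level R k)) (2 ^ k.+1)%:R (e_ R 2)
    => a b c d e.
  move: (level R k)^-1 d^-1 => t s; lra.
rewrite EFinD leeD2r//.
have -> : (D * l)%:E = (((2 + e_ R 2) * l)%:E * (4 * expR 1)%:E)%E.
  by rewrite -EFinM /D /piece_const; congr EFin; ring.
rewrite -muleA EFinM; apply: lee_pmul => //.
  rewrite lee_fin mulr_ge0 ?(ltW l_gt0)//; have := e2_ge1 R; lra.
rewrite lee_fin mulr_ge0// mulr_ge0 ?(le_trans ler01 l1)//.
exact: le_trans ler01 (log2_ge1 (le_trans ler01 T1)).
Qed.

(** The pieces partition the circle, so the integrals on the right of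
[W_term_piece] add up to the integral of [phi (u) + B], and the remaining summands
form a geometric series of sum [2 * l]. *)
Lemma W_norm_le : (\int[mu]_(x in @circle R) (phi (u x))%:E <= 1)%E ->
  (W_norm f <= ((D * (1 + B) + 2) * l)%:E)%E.
Proof.
move=> int_le1.
apply: ge_ereal_inf; exists (\sum_(k <oo) W_term k (g k))%E.
  by exists g => //; exact: level_pieces_decompose.
have phiB0 x : (0 <= (phi (u x) + B)%:E)%E by rewrite lee_fin addr_ge0 ?phi_ge0.
have J0 k : (0 <= \int[mu]_(x in E k) (phi (u x) + B)%:E)%E by exact: integral_ge0.
have Dl0 : 0 <= D * l by rewrite mulr_ge0 ?(ltW l_gt0).
apply: (le_trans (lee_nneseries _ (fun k _ => (W_term_piece k).2))).
  by move=> k _ _; exact: (W_term_piece k).1.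
apply: (le_trans (epsilon_trick _ _ _)).
- by move=> k; rewrite mule_ge0.
- by rewrite mulr_ge0 ?ltW.
rewrite (mulrDl _ 2) (EFinD _ (2 * l)); apply: leeD2r.
rewrite nneseriesZl//.
have Ecirc : \bigcup_k E k = @circle R.
  rewrite /E -setI_bigcupr; apply/setIidl => x _.
  by have [k kx] := in_level_ex (u_ge0 x); exists k.
have pm : measurable_fun (@circle R) (fun x => (phi (u x) + B)%:E).
  by apply/measurable_EFinP; exact: measurable_funD.
rewrite -ge0_integral_bigcup//; last 2 first.
- by rewrite Ecirc.
- apply/trivIsetP => i j _ _ /eqP ij; apply/seteqP; split=> // x [[_ ix] [_ jx]].
  by apply: ij; exact: in_level_inj ix jx.
rewrite Ecirc (mulrAC D) (EFinM (D * l)); apply: lee_wpmul2l => //.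
under eq_integral do rewrite EFinD.
have phi0 x : @circle R x -> (0 <= (phi (u x))%:E)%E by rewrite lee_fin phi_ge0.
have Be0 x : @circle R x -> (0 <= B%:E)%E by rewrite lee_fin.
have phim : measurable_fun (@circle R) (EFin \o (phi \o u)).
  exact/measurable_EFinP.
rewrite (ge0_integralD mu mcircle phi0 phim Be0 (measurable_cst _)).
have -> : (\int[mu]_(x in @circle R) B%:E = B%:E)%E.
  apply: (eq_trans (integral_cst mu mcircle _)).
  exact: eq_trans (congr1 (mule _) mu_circle) (mule1 _).
by rewrite EFinD leeD2r.
Qed.

End Decomposition.

Theorem mainTheorem3 (R : realType) (phi4 : R -> R)
    (phi4_young : young phi4)
    (phi4E : forall t : R, e_ R 4 < t -> phi4 t = t * log_ 2 t * log_ 4 t) :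
  exists2 C : R, 0 < C &
    forall f : R -> R[i], orlicz_space phi4 f ->
      (W_norm f <= C%:E * orlicz_norm phi4 f)%E.
Proof.
have [phi0 phi_homo _ _] := phi4_young.
have phi_ge0 t : 0 <= t -> 0 <= phi4 t.
  by move=> t0; rewrite -phi0; apply: phi_homo; rewrite // in_itv/= ?lexx ?t0.
have C0 : 0 < piece_const R * (1 + base_weight R) + 2.
  rewrite ltr_wpDl//; apply: mulr_ge0 (piece_const_ge0 R) _.
  by rewrite addr_ge0// base_weight_ge0.
exists (piece_const R * (1 + base_weight R) + 2) => // f [f_meas _].
rewrite -lee_pdivrMl//; apply: le_ereal_inf_tmp => _ [l [l0 int_le1] <-].
rewrite lee_pdivrMl// -EFinM.
exact: (W_norm_le phi_ge0 phi_homo phi4E f_meas l0 int_le1).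
Qed.
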